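(* The approximation ratio of RepeatedGreedy for the problem of maximizing a non-negative submodular function subject to a $k$-extendible system constraint is $k+\Omega(\sqrt{k})$, regardless of the number $\ell$ of iterations used by the algorithm. That is, there is a constant $c>0$ such that for infinitely many $k$ (namely all $k$ with $\sqrt{k}$ an integer) there is an instance with a $k$-extendible constraint and a non-negative submodular objective on which, for every $\ell\ge1$, the output $S$ of RepeatedGreedy satisfies $f(OPT)/f(S)\ge k+c\sqrt{k}$.
   Context: $f$ submodular: $f(X\cup Y)+f(X\cap Y)\le f(X)+f(Y)$; $f(u\mid S)=f(S\cup\{u\})-f(S)$; $S+u=S\cup\{u\}$. Independence system: non-empty down-closed $\mathcal{I}\subseteq2^{\mathcal{N}}$; $k$-extendible: for all $A\subseteq B\in\mathcal{I}$ and $u\notin B$ with $A+u\in\mathcal{I}$ there is $Y\subseteq B\setminus A$, $|Y|\le k$, with $(B\setminus Y)\cup\{u\}\in\mathcal{I}$. $OPT$ maximizes $f$ over $\mathcal{I}$. Greedy$(\mathcal{N}',f,\mathcal{I})$: $S=\varnothing$; while some $u\in\mathcal{N}'\setminus S$ has $S+u\in\mathcal{I}$ and $f(u\mid S)>0$, add such $u$ maximizing $f(u\mid S)$; return $S$. USM$(A,f)$ is any subroutine returning a subset of $A$ (intended as an approximate unconstrained maximizer of $f$ over subsets of $A$). RepeatedGreedy$(\mathcal{N},f,\mathcal{I},\ell)$: $\mathcal{N}_1=\mathcal{N}$; for $i=1,\dots,\ell$: $S_i=$Greedy$(\mathcal{N}_i,f,\mathcal{I})$, $S_i'=$USM$(S_i,f)$,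 $\mathcal{N}_{i+1}=\mathcal{N}_i\setminus S_i$. Return the set maximizing $f$ among $S_1,S_1',\dots,S_\ell,S_\ell'$. *)

(* Defs.v *)
From HB Require Import structures.
From mathcomp Require Import all_boot all_order all_algebra.
From mathcomp Require Import reals.

Set Implicit Arguments.
Unset Strict Implicit.
Unset Printing Implicit Defensive.

Import Order.TTheory GRing.Theory Num.Theory.
Local Open Scope ring_scope.

Section Defs.
Variables (R : realType) (T : finType).
Implicit Types (f : {set T} -> R) (I : {set {set T}}).
Implicit Types (A B N S X Y O : {set T}) (u v : T).

Definition nonnegative f := forall X, 0 <= f X.

Definition submodular f :=
  forall X Y, f (X :|: Y) + f (X :&: Y) <= f X + f Y.

(* f(u | S) *)
Definition marginal f u S : R := f (S :|: [set u]) - f S.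

Definition independence_system I :=
  I != set0 /\ forall A B, A \subset B -> B \in I -> A \in I.

Definition k_extendible (k : nat) I :=
  forall A B u, A \subset B -> B \in I -> u \notin B -> A :|: [set u] \in I ->
    exists Y, [/\ Y \subset B :\: A, (#|Y| <= k)%N
                & (B :\: Y) :|: [set u] \in I].

Definition is_opt f I O := O \in I /\ forall X, X \in I -> f X <= f O.

Definition candidate N f I S u :=
  [/\ u \in N :\: S, S :|: [set u] \in I & 0 < marginal f u S].

(* Ties are broken arbitrarily, so the greedy algorithm is a relation:
   [greedy_from N f I S S'] says that, started from the current set S, the
   while loop can terminate with S'. *)
Inductive greedy_from N f I : {set T} -> {set T} -> Prop :=
| greedy_stop S :
    (forall u, ~ candidate N f I S u) -> greedy_from N f I S S
| greedy_step S S' u :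
    candidate N f I S u ->
    (forall v, candidate N f I S v -> marginal f v S <= marginal f u S) ->
    greedy_from N f I (S :|: [set u]) S' ->
    greedy_from N f I S S'.

Definition greedy N f I S := greedy_from N f I set0 S.

(* A possibly randomized subroutine: [usm A f B] says that B is a possible
   answer on input (A, f). *)
Definition subroutine := {set T} -> ({set T} -> R) -> {set T} -> Prop.

Definition is_usm (usm : subroutine) :=
  forall A f B, usm A f B -> B \subset A.

(* [N_ i], [S_ i], [S'_ i] are only constrained at the indices used by the
   algorithm, 1 <= i <= l (and l + 1 for [N_]). *)
Definition repeated_greedy (usm : subroutine) N f I (l : nat) S :=
  exists N_ S_ S'_ : nat -> {set T},
    [/\ N_ 1 = N,
        forall i, (1 <= i <= l)%N ->
          [/\ greedy (N_ i) f I (S_ i), usm (S_ i) f (S'_ i)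
            & N_ i.+1 = N_ i :\: S_ i],
        exists i, (1 <= i <= l)%N /\ (S = S_ i \/ S = S'_ i)
      & forall i, (1 <= i <= l)%N -> f (S_ i) <= f S /\ f (S'_ i) <= f S].

End Defs.

(* Main.v *)
Require Import Defs.
From HB Require Import structures.
From mathcomp Require Import all_boot all_order all_algebra.
From mathcomp Require Import reals.
From mathcomp Require Import zify lra.
Import Order.TTheory GRing.Theory Num.Theory.
Local Open Scope ring_scope.

(** Write [k = n ^ 2]. The optimum is a set of [k + n] good elements, indexed by
   [n] rows of [n + 1] slots, each of value [D]. Every good element has a decoy
   of value slightly above [D], next to which it is worth only [1] more. A decoy
   is compatible with [n + 1] good elements and hence excludes only [k - 1] of
   them. The decoy of a leading slot [(i, None)] is compatible with its row, but
   makes the other slots of the row worthless; it takes all [n] rows to destroy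
   the optimum in this way, which is why [f] can be non-negative. The decoy of
   another slot is compatible with the leading slots, which have been used up
   by the time such a decoy is chosen. So each run of greedy returns a single
   decoy with its good element, of value at most [D + 3], and removes both. *)

(** * The instance: ground set, compatibility graph and objective *)

Section Instance.
Variable n : nat.

Definition slot : finType := ('I_n * option 'I_n)%type.

(* [(o, true)] is the decoy of the good element [(o, false)]. *)
Definition elt : finType := (slot * bool)%type.

Implicit Types (o : slot) (x y u v : elt) (A B N S X Y : {set elt}).

Definition leading o := o.2 == None.

Definition leader o : slot := (o.1, None).

Definition row_compatible o o' :=
  if leading o then o'.1 == o.1 else leading o' || (o' == o).

Definition compatible x y :=
  match x.2, y.2 with
  | true, true => x.1 == y.1
  | true, false => row_compatible x.1 y.1
  | false, true => row_compatible y.1 x.1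
  | false, false => true
  end.

Definition cliques : {set {set elt}} :=
  [set X : {set elt} | [forall x in X, forall y in X, compatible x y]].

(** Linear in [n], so that the surplus of at most 3 in a greedy answer costs only a factor
    [1 + O(1/n)]: of the ratio [k + n], at least [k + n/2] survives. *)
Definition good_value : nat := (9 * n).+1.

(** The extra unit for leading decoys makes greedy prefer them to all others. *)
Definition slot_value o (good decoy : bool) : nat :=
  if decoy then (good_value + (leading o).+1 + good)%N
  else if good then good_value else 0%N.

Definition hurt o X := ~~ leading o && ((leader o, true) \in X).

Definition slot_term o X : nat :=
  if hurt o X then 0%N
  else slot_value o ((o, false) \in X) ((o, true) \in X).

Definition objective X : nat := \sum_(o : slot) slot_term o X.

(** * The constraint is a [k]-extendible system *)

Lemma cliquesP X :
  reflect {in X &, forall x y, compatible x y} (X \in cliques).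
Proof.
rewrite inE; apply: (iffP forall_inP) => [h x y xX yX|h x xX].
  by move/forall_inP: (h x xX) => /(_ y yX).
by apply/forall_inP => y yX; apply: h.
Qed.

Lemma row_compatible_refl o : row_compatible o o.
Proof. by rewrite /row_compatible !eqxx orbT; case: ifP. Qed.

Lemma compatible_refl x : compatible x x.
Proof. by case: x => o [] //=; rewrite /compatible /= eqxx. Qed.

Lemma compatible_sym x y : compatible x y = compatible y x.
Proof. by case: x y => [o []] [o' []]; rewrite /compatible //= eq_sym. Qed.

Lemma independence_system_cliques : independence_system cliques.
Proof.
split; first by apply/set0Pn; exists set0; apply/cliquesP => x y; rewrite inE.
move=> A B /subsetP sAB /cliquesP hB; apply/cliquesP => x y xA yA.
by apply: hB; apply: sAB.
Qed.

Lemma set1_clique x : [set x] \in cliques.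
Proof. by apply/cliquesP => y z /set1P -> /set1P ->; apply: compatible_refl. Qed.

Lemma card_slot : #|{: slot}| = (n * n.+1)%N.
Proof. by rewrite card_prod card_option card_ord. Qed.

Lemma card_row_compatible o : #|[set o' | row_compatible o o']| = n.+1.
Proof.
case: o => i [j|].
  have -> : [set o' | row_compatible (i, Some j) o'] =
            (i, Some j) |: [set (i', None) | i' : 'I_n].
    apply/setP => -[i' [j'|]]; rewrite !inE /row_compatible /leading /=.
      by rewrite orbC; case: imsetP => [[? _ []]|]; rewrite ?orbF.
    by rewrite imset_f ?orbT.
  rewrite cardsU1 card_imset ?card_ord; last by move=> ? ? [].
  by case: imsetP => [[? _ []]|].
have -> : [set o' | row_compatible (i, None) o'] =
          [set (i, s) | s : option 'I_n].
  apply/setP => -[i' s]; rewrite !inE /row_compatible /leading /=.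
  apply/eqP/imsetP => [->|[s' _ [-> _]] //].
  by exists s.
by rewrite card_imset ?card_option ?card_ord // => ? ? [].
Qed.

Lemma card_row_incompatible o :
  #|~: [set o' | row_compatible o o']| = (n * n.+1 - n.+1)%N.
Proof. by rewrite cardsCs setCK card_slot card_row_compatible. Qed.

(** Since independence is a pairwise condition, it suffices to remove from [B] what is incompatible
    with [u]; nothing of [A] is removed, as [A + u] is a clique. *)
Lemma k_extendible_cliques : k_extendible (n * n) cliques.
Proof.
move=> A B u sAB /cliquesP hB uB /cliquesP hAu.
have n0 : (0 < n)%N by case: u.1.1 => m; apply: leq_ltn_trans.
exists [set y in B | ~~ compatible y u]; split.
- apply/subsetP => y; rewrite !inE => /andP[yB ny]; rewrite yB andbT.
  by apply: contra ny => yA; apply: hAu; rewrite !inE ?yA ?eqxx ?orbT.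
- have [o' /= oB|noB] := pickP [pred o | (o, true) \in B]; last first.
    case: u {uB hAu} => o b.
    apply: (@leq_trans #|[set (o', false) | o' in ~: [set o' | row_compatible o o']]|).
      apply/subset_leq_card/subsetP => -[o' []]; rewrite !inE.
        by have /= -> := noB o'.
      move=> /andP[_]; case: b => //= h.
      by apply: imset_f; rewrite !inE.
    rewrite card_imset; last by move=> ? ? [].
    rewrite card_row_incompatible; nia.
  (* Decoys are pairwise incompatible, so [B] has no other decoy than that of [o']. It accounts for
     at most one removal; good elements are removed only if [u] is a decoy, and then at most
     [n * n - 1] of them. *)
  case: u uB hAu => o b uB hAu.
  apply: (@leq_trans #|(o', true) |: [set (p, false) | p in
     [set p | row_compatible o' p] :\: [set p | row_compatible o p]]|).
    apply/subset_leq_card/subsetP => -[p []]; rewrite !inE.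
      move=> /andP[pB _]; have /eqP/= -> := hB _ _ pB oB.
      by rewrite eqxx.
    move=> /andP[pB]; case: b uB hAu => //= uB _ h.
    by apply/orP; right; apply: imset_f; rewrite !inE h; apply: (hB _ _ oB pB).
  rewrite cardsU1 card_imset; last by move=> ? ? [].
  set m := #|_ :\: _|.
  have m1 : (m <= n.+1)%N.
    by rewrite -(card_row_compatible o') subset_leq_card // subsetDl.
  have m2 : (m <= n * n.+1 - n.+1)%N.
    by rewrite -(card_row_incompatible o) subset_leq_card // setDE subsetIr.
  have : ((o', true) \notin [set (p, false) | p in
     [set p | row_compatible o' p] :\: [set p | row_compatible o p]] <= 1)%N.
    by case: (_ \notin _).
  have [n1|n1] : n = 1%N \/ (2 <= n)%N by lia.
    by rewrite n1 in m1 m2 *; lia.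
  nia.
apply/cliquesP => x y; rewrite !inE.
case: (eqVneq x u) => [->|_]; case: (eqVneq y u) => [->|_];
  rewrite ?orbT ?orbF ?compatible_refl //.
- by case: (y \in B); rewrite ?andbF //= andbT negbK compatible_sym.
- by case: (x \in B); rewrite ?andbF //= andbT negbK.
- by move=> /andP[_ xB] /andP[_ yB]; apply: hB.
Qed.

(** * Submodularity of the objective *)

Lemma slot_term_submod o X Y :
  (slot_term o (X :|: Y) + slot_term o (X :&: Y)
     <= slot_term o X + slot_term o Y)%N.
Proof.
(* For a slot that is not leading, a leader's decoy in just one of [X] and [Y] kills the term of the
   union, and monotonicity of [slot_value] bounds the intersection by the other set. Otherwise only
   the submodularity of [slot_value] matters. *)
rewrite /slot_term /hurt /slot_value /good_value !inE.
case: (leading o) => /=; case: ((leader o, true) \in X);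
case: ((leader o, true) \in Y); case: ((o, true) \in X);
case: ((o, true) \in Y); case: ((o, false) \in X);
case: ((o, false) \in Y) => /=; lia.
Qed.

Lemma objective_submod X Y :
  (objective (X :|: Y) + objective (X :&: Y) <= objective X + objective Y)%N.
Proof.
rewrite /objective -!big_split /=; apply: leq_sum => o _.
exact: slot_term_submod.
Qed.

Lemma slot_term_eq0 o X :
  (o, false) \notin X -> (o, true) \notin X -> slot_term o X = 0%N.
Proof.
by rewrite /slot_term /slot_value => /negbTE -> /negbTE ->; case: ifP.
Qed.

(** * Values of sets within one slot, and of the good elements *)

Definition slot_pair o : {set elt} := [set (o, false); (o, true)].

Lemma objective_pair o X : X \subset slot_pair o -> objective X = slot_term o X.
Proof.
move=> /subsetP sX; rewrite /objective (bigD1 o) //= big1 ?addn0 // => o' no'.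
by apply: slot_term_eq0; apply: contra no' => /sX; rewrite !inE !xpair_eqE;
  case/orP => /andP[].
Qed.

Lemma hurt_pair o X : X \subset slot_pair o -> hurt o X = false.
Proof.
move=> /subsetP sX; rewrite /hurt; apply/andP => -[no /sX].
rewrite !inE !xpair_eqE andbF /= andbT => /eqP e.
by move: no; rewrite -e /leading /leader eqxx.
Qed.

Lemma objective_pair_le o X :
  X \subset slot_pair o -> (objective X <= good_value + 3)%N.
Proof.
move=> sX; rewrite (objective_pair _ _ sX) /slot_term hurt_pair // /slot_value.
case: (leading o); do 2! [case: (_ \in X)]; lia.
Qed.

Lemma objective_set0 : objective set0 = 0%N.
Proof.
by rewrite /objective big1 // => o _; apply: slot_term_eq0; rewrite inE.
Qed.

Lemma sub1_pair o b : [set (o, b)] \subset slot_pair o.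
Proof. by rewrite sub1set !inE; case: b; rewrite eqxx ?orbT. Qed.

Lemma objective_set1 o b : objective [set (o, b)] = slot_value o (~~ b) b.
Proof.
have s1 := sub1_pair o b.
by rewrite (objective_pair _ _ s1) /slot_term hurt_pair // !inE !xpair_eqE eqxx;
  case: b {s1}.
Qed.

Definition good_elements : {set elt} := [set x | ~~ x.2].

Lemma good_elements_clique : good_elements \in cliques.
Proof. by apply/cliquesP => -[o []] [o' []]; rewrite !inE. Qed.

Lemma objective_good_elements :
  objective good_elements = (n * n.+1 * good_value)%N.
Proof.
rewrite /objective -card_slot -sum_nat_const; apply: eq_bigr => o _.
by rewrite /slot_term /hurt /slot_value !inE andbF.
Qed.

(** A zero gain keeps greedy from adding the other good elements of a row once the leading decoy is
    chosen. *)
Lemma objective_hurt S o :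
  hurt o S -> objective (S :|: [set (o, false)]) = objective S.
Proof.
move=> h; apply: eq_bigr => o' _; rewrite /slot_term.
have -> : hurt o' (S :|: [set (o, false)]) = hurt o' S.
  by rewrite /hurt !inE !xpair_eqE andbF orbF.
case: ifP => // nh; rewrite !inE !xpair_eqE andbF orbF andbT.
by case: eqP nh => [->|]; rewrite ?h ?orbF.
Qed.

(** The invariant of the ground sets [N_ i]: no good element outlives its decoy. *)
Definition decoy_closed N := forall o, (o, false) \in N -> (o, true) \in N.

(** * Runs of greedy *)

Section Greedy.
Variable R : realType.

Definition objectiveR X : R := (objective X)%:R.

Lemma nonnegative_objectiveR : nonnegative objectiveR.
Proof. by move=> X; apply: ler0n. Qed.

Lemma submodular_objectiveR : submodular objectiveR.
Proof. by move=> X Y; rewrite /objectiveR -!natrD ler_nat objective_submod. Qed.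

Lemma marginal_gt0 u S :
  (0 < marginal objectiveR u S) = (objective S < objective (S :|: [set u]))%N.
Proof. by rewrite /marginal subr_gt0 ltr_nat. Qed.

Lemma marginal_set0 u : marginal objectiveR u set0 = (objective [set u])%:R.
Proof. by rewrite /marginal /objectiveR set0U objective_set0 subr0. Qed.

Lemma candidate_set0 N u : u \in N -> candidate N objectiveR cliques set0 u.
Proof.
move=> uN; split; first by rewrite !inE.
  by rewrite set0U set1_clique.
rewrite marginal_gt0 set0U objective_set0; case: u {uN} => o b.
by rewrite objective_set1 /slot_value; case: b => //=; lia.
Qed.

Lemma candidate_own N S o :
    (o, true) \in S -> S \subset slot_pair o ->
    (o, false) \in N -> (o, false) \notin S ->
  candidate N objectiveR cliques S (o, false).
Proof.
move=> oS sS oN noS.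
have sS' : S :|: [set (o, false)] \subset slot_pair o by rewrite subUset sS sub1_pair.
split; first by rewrite inE noS.
  apply/cliquesP => x y /(subsetP sS') + /(subsetP sS').
  by rewrite !inE => /orP[]/eqP-> /orP[]/eqP->; rewrite /compatible //=
    ?eqxx ?row_compatible_refl.
rewrite marginal_gt0 !(objective_pair o) // /slot_term !hurt_pair // !inE oS.
by rewrite (negbTE noS) eqxx /slot_value /=; lia.
Qed.

(** Another decoy is incompatible with that of [o]. A compatible good element of another slot is
    hurt if [o] is leading; otherwise it is leading itself, hence no longer in [N]. *)
Lemma candidate_next N S o v :
    (leading o \/ forall o', leading o' -> (o', false) \notin N) ->
    (o, true) \in S -> S \subset slot_pair o ->
  candidate N objectiveR cliques S v -> v = (o, false).
Proof.
move=> ho oS sS []; rewrite inE => /andP[vS vN] /cliquesP clS.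
have := clS (o, true) v; rewrite !inE oS eqxx orbT => /(_ isT isT).
case: v vS vN {clS} => o' [] vS vN; rewrite /compatible /=.
  by move=> /eqP e; rewrite -e oS in vS.
rewrite marginal_gt0 => cmp mg; have [-> //|no'] := eqVneq o' o.
move: cmp; rewrite /row_compatible; case: ifP ho => [lo _ /eqP e|_ [//|ho]].
  suff h : hurt o' S by move: mg; rewrite objective_hurt // ltnn.
  case: o o' lo e oS no' {vS vN mg sS} => i s [i' s'] /eqP /= -> -> oS.
  by rewrite xpair_eqE eqxx /= /hurt oS andbT.
by rewrite (negbTE no') orbF => /ho; rewrite vN.
Qed.

Lemma greedy_from_decoy N S S' o :
    (leading o \/ forall o', leading o' -> (o', false) \notin N) ->
    greedy_from N objectiveR cliques S S' -> (o, true) \in S -> S \subset slot_pair o ->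
  [/\ (o, true) \in S', S' \subset slot_pair o
    & (o, false) \in N -> (o, false) \in S'].
Proof.
move=> ho; elim=> {S S'} [S stop oS sS|S S' u cu _ _ IH oS sS].
  split=> // oN; apply: contraT => noS.
  by case: (stop (o, false)); apply: candidate_own.
have eu := candidate_next _ _ _ _ ho oS sS cu.
by apply: IH; rewrite ?inE ?oS // subUset sS eu sub1_pair.
Qed.

Lemma greedy_pair N S : decoy_closed N -> greedy N objectiveR cliques S ->
  S = set0 /\ N = set0 \/
  exists o, [/\ (o, true) \in S, S \subset slot_pair o
    & (o, false) \in N -> (o, false) \in S].
Proof.
move=> cN; rewrite /greedy; move e0: {1}set0 => Z gS.
case: Z S / gS e0 => [S0 stop S00|S0 S1 u cu mu gS S00].
  left; split=> //; apply/eqP; rewrite -subset0; apply/subsetP => u uN.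
  by case: (stop u); rewrite -S00; apply: candidate_set0.
right; rewrite -{S0}S00 set0U in cu mu gS.
have uN : u \in N by case: cu; rewrite !inE.
have {}mu v : v \in N -> (objective [set v] <= objective [set u])%N.
  by move=> /candidate_set0 /mu; rewrite !marginal_set0 ler_nat.
case: u uN gS mu {cu} => o [] uN gS mu; last first.
  (* A good element cannot be the first choice: its decoy is available and worth more. *)
  have := mu _ (cN _ uN); rewrite !objective_set1 /slot_value /=; lia.
exists o; apply: (greedy_from_decoy _ _ _ _ _ gS); rewrite ?set11 ?sub1_pair //.
(* A leading good element still in [N] would have its decoy in [N], which would beat a decoy that is
   not leading. *)
case lo: (leading o); [by left|right] => o' lo'; apply/negP => /cN /mu.
by rewrite !objective_set1 /slot_value lo lo' /=; lia.
Qed.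

(** Stated for subsets so as to cover the answers of the subroutine as well. *)
Lemma greedy_subset_le N S X : decoy_closed N -> greedy N objectiveR cliques S ->
  X \subset S -> (objective X <= good_value + 3)%N.
Proof.
move=> cN /(greedy_pair _ _ cN) [[-> _]|[o [_ sS _]]] sX.
  by move: sX; rewrite subset0 => /eqP ->; rewrite objective_set0.
by apply: (@objective_pair_le o); apply: subset_trans sS.
Qed.

(** The only decoy that a run removes takes its good element with it, if that was still present. *)
Lemma decoy_closed_greedy N S :
  decoy_closed N -> greedy N objectiveR cliques S -> decoy_closed (N :\: S).
Proof.
move=> cN /(greedy_pair _ _ cN) [[_ ->] o|[o [_ /subsetP sS hS]] o'].
  by rewrite !inE andbF.
rewrite !inE => /andP[oS oN]; rewrite cN // andbT.
apply: contra oS => /sS; rewrite !inE !xpair_eqE andbF andbT /= => /eqP e.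
by rewrite e in oN *; apply: hS.
Qed.

Lemma greedy_objective_gt0 N S : decoy_closed N -> N != set0 ->
  greedy N objectiveR cliques S -> (0 < objective S)%N.
Proof.
move=> cN N0 /(greedy_pair _ _ cN) [[_ e]|[o [oS sS _]]].
  by rewrite e eqxx in N0.
by rewrite (objective_pair _ _ sS) /slot_term hurt_pair // /slot_value oS.
Qed.

(** Positivity is needed because a quotient by 0 is 0 by convention; it comes from the first run,
    whose ground set is non-empty. *)
Lemma repeated_greedy_bounds (usm : subroutine R elt) l S :
    (0 < n)%N -> is_usm usm -> (1 <= l)%N ->
    repeated_greedy usm [set: elt] objectiveR cliques l S ->
  (0 < objective S <= good_value + 3)%N.
Proof.
move=> n0 husm l1 [N_ [S_ [S'_ [N1 run [j [jl Sj]] best]]]].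
have closed i : (1 <= i <= l)%N -> decoy_closed (N_ i).
  elim: i => // -[_ _|i IH il]; first by rewrite N1 => o _; rewrite inE.
  have il' : (1 <= i.+1 <= l)%N by lia.
  have [gi _ ->] := run _ il'; apply: decoy_closed_greedy gi; exact: IH.
apply/andP; split.
  have h1 : (1 <= 1 <= l)%N by lia.
  have [g1 _ _] := run _ h1; have [+ _] := best _ h1.
  rewrite ler_nat; apply: leq_trans.
  apply: (greedy_objective_gt0 _ _ (closed _ h1)) g1; rewrite N1.
  by apply/set0Pn; exists ((Ordinal n0, None), true); rewrite inE.
have [gj uj _] := run _ jl; apply: (greedy_subset_le _ _ _ (closed _ jl) gj).
by case: Sj => -> //; apply: husm uj.
Qed.

End Greedy.
End Instance.

(** * The ratio for square [k] *)

Lemma sqrt_nat_int (R : realType) (k : nat) :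
  Num.sqrt (k%:R : R) \is a Num.int -> exists n, k = (n * n)%N.
Proof.
move=> ki; have : Num.sqrt (k%:R : R) \is a Num.nat.
  by rewrite natrEint ki sqrtr_ge0.
move=> /natrP [n en]; exists n; apply/eqP.
by rewrite -(eqr_nat R) natrM -en -expr2 sqr_sqrtr.
Qed.

Theorem theorem32 (R : realType) :
  exists c : R, 0 < c /\
    forall k : nat, Num.sqrt (k%:R : R) \is a Num.int ->
      exists (T : finType) (f : {set T} -> R) (I : {set {set T}}),
        [/\ nonnegative f, submodular f, independence_system I,
            k_extendible k I
          & forall (usm : subroutine R T) (l : nat) (OPT S : {set T}),
              is_usm usm -> (1 <= l)%N -> is_opt f I OPT ->
              repeated_greedy usm [set: T] f I l S ->
              k%:R + c * Num.sqrt k%:R <= f OPT / f S].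
Proof.
exists 2^-1; split=> [|k /sqrt_nat_int [n ->]]; first by lra.
exists (elt n), (objectiveR n R), (cliques n); split.
- exact: nonnegative_objectiveR.
- exact: submodular_objectiveR.
- exact: independence_system_cliques.
- exact: k_extendible_cliques.
move=> usm l OPT S husm l1 [_ opt] rg.
rewrite natrM -expr2 sqrtr_sqr ger0_norm ?ler0n //.
have [n0|n0] := posnP n.
  (* For [k = 0] the bound to reach is 0. *)
  rewrite (_ : n%:R = 0 :> R) ?n0 // expr2 !mulr0 addr0.
  by rewrite divr_ge0 // ler0n.
have /andP[S0 Sle] := repeated_greedy_bounds _ _ _ _ _ n0 husm l1 rg.
have := opt _ (good_elements_clique n).
rewrite /objectiveR objective_good_elements ler_pdivlMr ?ltr0n //.
apply: le_trans; move: Sle; rewrite -(ler_nat R) => Sle.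
apply: (@le_trans _ _ ((n%:R ^+ 2 + 2^-1 * n%:R) * (good_value n + 3)%:R)).
  by apply: ler_wpM2l => //; rewrite addr_ge0 ?mulr_ge0 ?invr_ge0 ?ler0n ?exprn_ge0.
move: n0; rewrite /good_value -(ler_nat R) => n1.
(* After division by [n] the claim is [(n + 1/2)(9n + 4) <= (n + 1)(9n + 1)], that is,
   [1 <= 3n/2]. *)
rewrite -[(9 * n).+1]addn1 -[n.+1]addn1 !(natrD, natrM) expr2.
nra.
Qed.
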